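(* Let $K\in\{1,2,3\}$, $\Delta y=\Delta x$, and let $\mathcal E$ be the evolution matrix of the Discontinuous Galerkin method of degree $K$ for two-dimensional linear acoustics with the upwind flux, i.e. with $D_x=\mathrm{diag}(1,0,1)$ and $D_y=\mathrm{diag}(0,1,1)$. Let $\mathbf k=(k_x,k_y)\in\mathbb R^2$ be fixed with $k_xk_y\ne0$, and let $\hat Q=(-k_y,k_x,0)^{\mathrm T}$. Then the order of accuracy associated to $\ker\mathcal E$ is at most $K$ (instead of $K+1$): there is no selectively optimal projector $\pi_{\mathbf k}$ onto $\ker\mathcal E$ such that $$\widehat{\mathrm{DOF}}(\hat Q)-\pi_{\mathbf k}\widehat{\mathrm{DOF}}(\hat Q)\in\mathcal O(\Delta x^{K+1})\qquad(\Delta x\to0).$$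
   Context: Linear acoustics in 2D with variables $q=(u,v,p)$: $\partial_t q+J_x\partial_x q+J_y\partial_y q=0$ with $$J_x=\begin{pmatrix}0&0&1\\0&0&0\\1&0&0\end{pmatrix},\qquad J_y=\begin{pmatrix}0&0&0\\0&0&1\\0&1&0\end{pmatrix}.$$ Note $\hat Q=(-k_y,k_x,0)^{\mathrm T}$ spans $\ker(J_xk_x+J_yk_y)$ for $\mathbf k\neq0$. Basis: $b_0,\dots,b_K$ is the $L^2(-\frac12,\frac12)$-orthonormal polynomial basis with $\deg b_k=k$ ($b_0=1$, $b_1=2\sqrt3x$, $b_2=\frac{\sqrt5}{2}(12x^2-1)$, $b_3=\sqrt7x(20x^2-3)$), so the mass matrix is $M^k_\alpha=\delta_{k\alpha}$. Put $G^k_\alpha=\int_{-1/2}^{1/2}b_k'(\xi)b_\alpha(\xi)\,d\xi$. Numerical fluxes: $\hat f^x(q_L,q_R)=J_x\frac{q_L+q_R}{2}-D_x\frac{q_R-q_L}{2}$, and analogously $\hat f^y$ with $J_y,D_y$. Evolution matrix: let $t_x=e^{\mathrm ik_x\Delta x}$, $t_y=e^{\mathrm ik_y\Delta y}$. Inserting $q_{ij}^{(\alpha\beta)}(t)=\hat q^{(\alpha\beta)}(t)t_x^it_y^j$ (with $\hat q^{(\alpha\beta)}\in\mathbb C^3$) in the semi-discrete DG method of tensor-product degree $K$ yields $\frac{d}{dt}\hat q^{(k\ell)}+\sum_{\alpha,\beta=0}^K\mathcal E^{k\ell}_{\alpha\beta}\hat q^{(\alpha\beta)}=0$, where the $3\times3$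 blocks of $\mathcal E\in\mathbb C^{3(K+1)^2\times3(K+1)^2}$ are $$\begin{aligned}\mathcal E^{k\ell}_{\alpha\beta}=&-\tfrac1{\Delta x}J_xM^\ell_\beta G^k_\alpha-\tfrac1{\Delta y}J_yM^k_\alpha G^\ell_\beta\\&+\frac{b_k(\frac12)t_x-b_k(-\frac12)}{t_x\Delta x}\left(J_x\frac{b_\alpha(\frac12)+t_xb_\alpha(-\frac12)}2-D_x\frac{t_xb_\alpha(-\frac12)-b_\alpha(\frac12)}2\right)M^\ell_\beta\\&+\frac{b_\ell(\frac12)t_y-b_\ell(-\frac12)}{t_y\Delta y}\left(J_y\frac{b_\beta(\frac12)+t_yb_\beta(-\frac12)}2-D_y\frac{t_yb_\beta(-\frac12)-b_\beta(\frac12)}2\right)M^k_\alpha .\end{aligned}$$ Degrees of freedom of the Fourier mode $\hat Q e^{\mathrm i\mathbf k\cdot\mathbf x}$: for $0\le k,\ell\le K$, $$\widehat{\mathrm{DOF}}(\hat Q)_{k\ell}=\hat Q\,\frac1{\Delta x\Delta y}\int_{-\Delta x/2}^{\Delta x/2}\int_{-\Delta y/2}^{\Delta y/2}b_k\!\left(\tfrac x{\Delta x}\right)b_\ell\!\left(\tfrac y{\Delta y}\right)e^{\mathrm ik_xx}e^{\mathrm ik_yy}\,dy\,dx\in\mathbb C^3 .$$ Selectively optimal projector: a map (more precisely, a family of maps depending on $\Delta x$) $\pi_{\mathbf k}:\mathbb C^{3(K+1)^2}\to\ker\mathcal E$, not required to be linear or idempotent (it may be affine), for which there is an index set $I\subset\{1,\dots,3(K+1)^2\}$,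 independent of $\Delta x$, with $\#I=\dim\ker\mathcal E$ for all small $\Delta x$ and $(\pi_{\mathbf k}\hat q)_i=\hat q_i+\mathcal O(\Delta x^{K+1})$ as $\Delta x\to0$ for all $i\in I$ and all $\hat q\in\mathbb C^{3(K+1)^2}$. *)

(* Defs.v *)
From HB Require Import structures.
From mathcomp Require Import all_boot all_order all_algebra.
From mathcomp Require Import complex.
From mathcomp Require Import all_classical all_reals all_analysis.

Set Implicit Arguments.
Unset Strict Implicit.
Unset Printing Implicit Defensive.

Import Order.TTheory GRing.Theory Num.Theory.
Import numFieldNormedType.Exports.

Local Open Scope classical_set_scope.
Local Open Scope ring_scope.
Local Open Scope complex_scope.

Section Complex.
Variable R : realType.

(* exp (i theta) *)
Definition cexpi (theta : R) : R[i] := cos theta +i* sin theta.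

Definition Cintegral (a b : R) (f : R -> R[i]) : R[i] :=
  (\int[lebesgue_measure]_(x in `[a, b]) complex.Re (f x))
  +i* (\int[lebesgue_measure]_(x in `[a, b]) complex.Im (f x)).

(* f(h) = O(h^n) as h decreases to 0 *)
Definition isO_right (f : R -> R[i]) (n : nat) : Prop :=
  (fun h : R => Normc.normc (f h) : R^o) =O_ (0^'+) (fun h : R => h ^+ n : R^o).

End Complex.

Section Basis.
Variable R : realType.

(* The orthonormal (rescaled Legendre) basis of L^2(-1/2, 1/2), which is needed
   only up to degree 3; the value 0 for k > 3 is a dummy. *)
Definition dgbasis (k : nat) : {poly R} :=
  match k with
  | 0 => 1
  | 1 => (2 * Num.sqrt 3) *: 'X
  | 2 => (Num.sqrt 5 / 2) *: (12 *: 'X^2 - 1)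
  | 3 => Num.sqrt 7 *: ('X * (20 *: 'X^2 - 3%:P))
  | _ => 0
  end.

Definition dgmass (k a : nat) : R :=
  \int[lebesgue_measure]_(x in `[- (2^-1), 2^-1])
    ((dgbasis k).[x] * (dgbasis a).[x]).

Definition dgstiff (k a : nat) : R :=
  \int[lebesgue_measure]_(x in `[- (2^-1), 2^-1])
    ((dgbasis k)^`().[x] * (dgbasis a).[x]).

End Basis.

Section Acoustics.
Variable R : realType.
Notation C := R[i].

(* The 3 x 3 matrices act on columns (u, v, p)^T. *)
Definition mx3 (s : seq (seq C)) : 'M[C]_3 := \matrix_(i, j) (nth [::] s i)`_j.
Definition diag3 (s : seq C) : 'M[C]_3 := diag_mx (\row_j s`_j).

Definition Jx : 'M[C]_3 := mx3 [:: [:: 0; 0; 1]; [:: 0; 0; 0]; [:: 1; 0; 0]].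
Definition Jy : 'M[C]_3 := mx3 [:: [:: 0; 0; 0]; [:: 0; 0; 1]; [:: 0; 1; 0]].

Definition Dx_upwind : 'M[C]_3 := diag3 [:: 1; 0; 1].
Definition Dy_upwind : 'M[C]_3 := diag3 [:: 0; 1; 1].

Definition Qhat (kx ky : R) : 'cV[C]_3 := \col_i [:: (- ky)%:C; kx%:C; 0]`_i.

End Acoustics.

Section DG.
Variables (R : realType) (K : nat).
Notation C := R[i].

(* A triple (k, l, c) stands for the component c of q^(kl); vectors in
   C^(3 (K + 1)^2) are indexed by the enumeration of these triples. *)
Definition dof_index : finType := ('I_K.+1 * 'I_K.+1 * 'I_3)%type.
Definition ndof : nat := #|{: dof_index}|.

Section Evolution.
Variables (Dx Dy : 'M[C]_3) (kx ky dx dy : R).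

Definition evolution_block (k l a b : nat) : 'M[C]_3 :=
  let tx := cexpi (kx * dx) in
  let ty := cexpi (ky * dy) in
  let bR n : C := ((dgbasis R n).[2^-1])%:C in
  let bL n : C := ((dgbasis R n).[- (2^-1)])%:C in
  let M n m : C := (dgmass R n m)%:C in
  let G n m : C := (dgstiff R n m)%:C in
  - ((dx%:C)^-1 * M l b * G k a) *: Jx R
  - ((dy%:C)^-1 * M k a * G l b) *: Jy R
  + ((bR k * tx - bL k) / (tx * dx%:C) * M l b) *:
      (((bR a + tx * bL a) / 2) *: Jx R - ((tx * bL a - bR a) / 2) *: Dx)
  + ((bR l * ty - bL l) / (ty * dy%:C) * M k a) *:
      (((bR b + ty * bL b) / 2) *: Jy R - ((ty * bL b - bR b) / 2) *: Dy).

Definition evolution : 'M[C]_ndof :=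
  \matrix_(r, s)
    let: (k, l, c) := enum_val r : dof_index in
    let: (a, b, d) := enum_val s : dof_index in
    evolution_block k l a b c d.

End Evolution.

Definition DOF (kx ky dx dy : R) (Q : 'cV[C]_3) : 'cV[C]_ndof :=
  \col_r
    let: (k, l, c) := enum_val r : dof_index in
    Q c 0 * ((dx * dy)^-1)%:C *
    Cintegral (- (dx / 2)) (dx / 2) (fun x =>
      Cintegral (- (dy / 2)) (dy / 2) (fun y =>
        ((dgbasis R k).[x / dx])%:C * ((dgbasis R l).[y / dy])%:C
        * cexpi (kx * x) * cexpi (ky * y))).

(* E h is the evolution matrix for the mesh size h, acting on columns: its
   kernel is {q | E h *m q = 0}, the row kernel of the transpose.  The constant
   and the range of h in the last clause may depend on q. *)
Definition selectively_optimal_projector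
    (E : R -> 'M[C]_ndof) (proj : R -> 'cV[C]_ndof -> 'cV[C]_ndof) : Prop :=
  (forall (h : R) (q : 'cV[C]_ndof), 0 < h -> E h *m proj h q = 0) /\
  exists I : {set 'I_ndof},
    (\forall h \near 0^'+, #|I| = \rank (kermx (E h)^T)) /\
    (forall (i : 'I_ndof) (q : 'cV[C]_ndof), i \in I ->
       isO_right (fun h => proj h q i 0 - q i 0) K.+1).

End DG.

(* Main.v *)
(** A vector in the kernel of the evolution matrix dissipates no energy, so its
    upwind jumps vanish: u and p are continuous across the x-faces, v and p across
    the y-faces.  Hence its divergence vanishes in every cell; since the y-derivative
    of v has y-degree below K, the y-mode K of u is constant in x, and being
    quasi-periodic with multiplier t_x <> 1 it is zero.  In particular the degree of
    freedom (0, K) of u vanishes on the kernel.  For the Fourier mode, Rodrigues'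
    formula and K integrations by parts show that this degree of freedom is bounded
    below by a constant times h ^ K.  No map into the kernel can therefore approximate
    it to order K + 1. *)
Require Import Defs.
From mathcomp Require Import all_boot all_order all_algebra.
From mathcomp Require Import complex ring lra.
From mathcomp Require Import all_classical all_reals all_analysis.

Set Implicit Arguments.
Unset Strict Implicit.
Unset Printing Implicit Defensive.

Import Order.TTheory GRing.Theory Num.Theory.
Import numFieldNormedType.Exports.
Local Open Scope classical_set_scope.
Local Open Scope ring_scope.
Local Open Scope complex_scope.

(** * Integrals of polynomials and trigonometric functions *)

Section RealIntegrals.
Variable R : realType.
Implicit Types (a b c h th : R) (p : {poly R}) (f g F : R -> R).

Lemma continuous_integrable f a b : continuous f ->
  lebesgue_measure.-integrable `[a, b] (EFin \o f).
Proof.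
move=> cf; apply: continuous_compact_integrable; first exact: segment_compact.
exact: continuous_subspaceT.
Qed.

Lemma Rintegral_derive f F a b : a < b -> continuous f ->
  (forall x : R, is_derive x 1 F (f x)) ->
  \int[lebesgue_measure]_(x in `[a, b]) f x = F b - F a.
Proof.
move=> ab cf dF; have cF : continuous F.
  move=> x; apply: differentiable_continuous; apply/derivable1_diffP.
  by case: (dF x).
rewrite /Rintegral (@continuous_FTC2 _ f F) //.
- exact: continuous_subspaceT.
- split; [by move=> x _; case: (dF x)| |].
  + by apply: cvg_at_right_filter; exact: cF.
  + by apply: cvg_at_left_filter; exact: cF.
- by move=> x _; rewrite derive1E; case: (dF x).
Qed.

Lemma continuous_horner_scale p c : continuous (fun x : R => p.[x / c]).
Proof.
move=> x; apply: (@continuous_comp _ _ _ (fun x : R => x / c) (horner p)).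
  by apply: cvgM; [exact: cvg_id|exact: cvg_cst].
exact: continuous_horner.
Qed.

Lemma is_derive_horner_scale p c (x : R) :
  is_derive x 1 (fun x : R => p.[x / c]) (p^`().[x / c] / c).
Proof.
have -> : (fun x : R => p.[x / c]) = horner (p \Po (c^-1 *: 'X)).
  by apply/funext => y; rewrite horner_comp !hornerE mulrC.
apply: (is_derive_eq (is_derive_poly _ _)).
rewrite deriv_comp hornerM horner_comp derivZ derivX -polyC1 !hornerZ hornerX hornerC.
by rewrite mulr1 [_ * x]mulrC.
Qed.

Lemma continuous_cos_scale c : continuous (fun x : R => cos (c * x)).
Proof.
move=> x; apply: (@continuous_comp _ _ _ (fun x : R => c * x) cos).
  by apply: cvgM; [exact: cvg_cst|exact: cvg_id].
exact: continuous_cos.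
Qed.

Lemma continuous_sin_scale c : continuous (fun x : R => sin (c * x)).
Proof.
move=> x; apply: (@continuous_comp _ _ _ (fun x : R => c * x) sin).
  by apply: cvgM; [exact: cvg_cst|exact: cvg_id].
exact: continuous_sin.
Qed.

Lemma is_derive_mull c (x : R) : is_derive x 1 ( *%R c) c.
Proof.
rewrite -[X in is_derive _ _ _ X]mulr1.
exact: (@is_deriveZ _ _ _ id c x 1 1).
Qed.

Lemma is_derive_cos_scale c (x : R) :
  is_derive x 1 (fun x : R => cos (c * x)) (- (c * sin (c * x))).
Proof.
rewrite mulrC -mulNr.
apply: (@is_derive1_comp _ cos ( *%R c) x _ _ _ (is_derive_mull c x)).
Qed.

Lemma is_derive_sin_scale c (x : R) :
  is_derive x 1 (fun x : R => sin (c * x)) (c * cos (c * x)).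
Proof.
rewrite mulrC.
apply: (@is_derive1_comp _ sin ( *%R c) x _ _ _ (is_derive_mull c x)).
Qed.

(** Phrased through a derivative, so that only values at the two ends of the reference cell appear
    and no primitive has to be named. *)
Lemma Rintegral_horner_scale p h : 0 < h ->
  \int[lebesgue_measure]_(x in `[- (h / 2), h / 2]) p^`().[x / h]
  = h * (p.[2^-1] - p.[- 2^-1]).
Proof.
move=> h0; have hN0 := lt0r_neq0 h0.
have dF (x : R) : is_derive x 1 (fun x : R => h * p.[x / h]) p^`().[x / h].
  have := @is_deriveZ _ _ _ (fun x : R => p.[x / h]) h x 1 _
    (is_derive_horner_scale p h x).
  by move/trigger_derive; apply; rewrite /GRing.scale /= mulrC mulfVK.
rewrite (Rintegral_derive _ _ dF); [|lra|exact: continuous_horner_scale].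
rewrite -mulrBr; congr (_ * (_.[_] - _.[_])).
  by rewrite mulrAC divff ?mul1r.
by rewrite mulNr mulrAC divff ?mul1r.
Qed.

Lemma Rintegral_horner p :
  \int[lebesgue_measure]_(x in `[- 2^-1, 2^-1]) p^`().[x]
  = p.[2^-1] - p.[- 2^-1].
Proof.
have := @Rintegral_horner_scale p 1 ltr01; rewrite !mul1r => <-.
by apply: eq_Rintegral => x _; rewrite divr1.
Qed.

Lemma continuous_horner_cos p c : continuous (fun x : R => p.[x] * cos (c * x)).
Proof.
by move=> x; apply: cvgM; [exact: continuous_horner|exact: continuous_cos_scale].
Qed.

Lemma continuous_horner_sin p c : continuous (fun x : R => p.[x] * sin (c * x)).
Proof.
by move=> x; apply: cvgM; [exact: continuous_horner|exact: continuous_sin_scale].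
Qed.

(** Integration by parts; the boundary terms drop out because [p] vanishes at both ends. *)
Lemma Rintegral_deriv_cos p c a b : a < b -> p.[a] = 0 -> p.[b] = 0 ->
  \int[lebesgue_measure]_(x in `[a, b]) (p^`().[x] * cos (c * x))
  = c * \int[lebesgue_measure]_(x in `[a, b]) (p.[x] * sin (c * x)).
Proof.
move=> ab pa pb.
have c1 (q : {poly R}) := @continuous_horner_cos q c.
have c2 (q : {poly R}) := @continuous_horner_sin q c.
apply/eqP; rewrite -subr_eq0 -RintegralZl //; last exact: continuous_integrable.
rewrite -RintegralB //; last first.
- by apply: continuous_integrable => x; apply: cvgM; [exact: cvg_cst|exact: c2].
- exact: continuous_integrable.
have dF (x : R) : is_derive x 1 (fun x : R => p.[x] * cos (c * x))
    (p^`().[x] * cos (c * x) - c * (p.[x] * sin (c * x))).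
  have := @is_deriveM _ _ _ _ x 1 _ _ (is_derive_poly p x)
    (is_derive_cos_scale c x).
  by move/trigger_derive; apply; rewrite /GRing.scale /=; ring.
rewrite (Rintegral_derive ab _ dF) ?pa ?pb ?mul0r ?subrr //.
move=> x; apply: cvgB; first exact: c1.
by apply: cvgM; [exact: cvg_cst|exact: c2].
Qed.

Lemma Rintegral_deriv_sin p c a b : a < b -> p.[a] = 0 -> p.[b] = 0 ->
  \int[lebesgue_measure]_(x in `[a, b]) (p^`().[x] * sin (c * x))
  = - (c * \int[lebesgue_measure]_(x in `[a, b]) (p.[x] * cos (c * x))).
Proof.
move=> ab pa pb.
have c1 (q : {poly R}) := @continuous_horner_cos q c.
have c2 (q : {poly R}) := @continuous_horner_sin q c.
apply/eqP; rewrite -addr_eq0 -RintegralZl //; last exact: continuous_integrable.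
rewrite -RintegralD //; last first.
- by apply: continuous_integrable => x; apply: cvgM; [exact: cvg_cst|exact: c1].
- exact: continuous_integrable.
have dF (x : R) : is_derive x 1 (fun x : R => p.[x] * sin (c * x))
    (p^`().[x] * sin (c * x) + c * (p.[x] * cos (c * x))).
  have := @is_deriveM _ _ _ _ x 1 _ _ (is_derive_poly p x)
    (is_derive_sin_scale c x).
  by move/trigger_derive; apply; rewrite /GRing.scale /=; ring.
rewrite (Rintegral_derive ab _ dF) ?pa ?pb ?mul0r ?subrr //.
move=> x; apply: cvgD; first exact: c2.
by apply: cvgM; [exact: cvg_cst|exact: c1].
Qed.

End RealIntegrals.

(** * The Legendre basis *)

Section Basis.
Variable R : realType.
Notation b := (dgbasis R).

(** Odd powers cancel by symmetry, and 1/12, 1/80, 1/448 are the moments of x^2, x^4, x^6. Degree 6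
    suffices for products of two basis polynomials. *)
Lemma Rintegral_sextic (c0 c1 c2 c3 c4 c5 c6 : R) (f : R -> R) :
  (forall x, f x = c0 + c1 * x + c2 * x ^+ 2 + c3 * x ^+ 3 + c4 * x ^+ 4
                   + c5 * x ^+ 5 + c6 * x ^+ 6) ->
  \int[lebesgue_measure]_(x in `[- 2^-1, 2^-1]) f x
  = c0 + c2 / 12 + c4 / 80 + c6 / 448.
Proof.
move=> fE; pose P : {poly R} := c0 *: 'X + (c1 / 2) *: 'X^2 + (c2 / 3) *: 'X^3
  + (c3 / 4) *: 'X^4 + (c4 / 5) *: 'X^5 + (c5 / 6) *: 'X^6 + (c6 / 7) *: 'X^7.
have dP x : P^`().[x] = f x.
  rewrite fE /P !derivD !derivZ !derivXn derivX !(hornerD, hornerZ, hornerMn).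
  rewrite !hornerXn hornerC -[2.-1]/1%N -[3.-1]/2%N -[4.-1]/3%N -[5.-1]/4%N.
  by rewrite -[6.-1]/5%N -[7.-1]/6%N; field.
under eq_Rintegral => x _ do rewrite -dP.
by rewrite Rintegral_horner /P !(hornerD, hornerZ) !hornerXn !hornerX; field.
Qed.

(** The irrational normalisation is kept apart from the rational polynomial factor [dgbasis_fun], so
    that integrals of products reduce to rational arithmetic. *)
Definition dgbasis_coef (k : nat) : R :=
  [:: 1; 2 * Num.sqrt 3; Num.sqrt 5 / 2; Num.sqrt 7]`_k.

Definition dgbasis_fun (k : nat) (x : R) : R :=
  [:: 1; x; 12 * x ^+ 2 - 1; 20 * x ^+ 3 - 3 * x]`_k.

Definition dgbasis_dfun (k : nat) (x : R) : R :=
  [:: 0; 1; 24 * x; 60 * x ^+ 2 - 3]`_k.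

Lemma horner_dgbasis k x : (k < 4)%N ->
  (b k).[x] = dgbasis_coef k * dgbasis_fun k x.
Proof.
case: k => [|[|[|[|//]]]] _; 
  cbv beta iota delta [nth dgbasis dgbasis_coef dgbasis_fun];
  rewrite ?hornerZ ?hornerM ?hornerD ?hornerN ?hornerZ ?hornerXn ?hornerX ?hornerC; ring.
Qed.

Lemma horner_deriv_dgbasis k x : (k < 4)%N ->
  (b k)^`().[x] = dgbasis_coef k * dgbasis_dfun k x.
Proof.
case: k => [|[|[|[|//]]]] _; 
  cbv beta iota delta [nth dgbasis dgbasis_coef dgbasis_dfun];
  rewrite -?polyC1 ?(derivZ, derivB, derivC, derivM, derivXn, derivX) -?[2.-1]/1%N
  ?(hornerD, hornerN, hornerM, hornerZ, hornerMn, hornerXn, hornerX, hornerC); ring.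
Qed.

Lemma dgbasis_coef_neq0 k : (k < 4)%N -> dgbasis_coef k != 0.
Proof.
case: k => [|[|[|[|//]]]] _; rewrite /dgbasis_coef /= ?oner_neq0 //;
  rewrite ?mulf_neq0 ?invr_neq0 ?pnatr_eq0 // gt_eqF // sqrtr_gt0 //.
Qed.

Lemma sqr_dgbasis_coef k : (k < 4)%N ->
  dgbasis_coef k ^+ 2 = [:: 1; 12; 5 / 4; 7]`_k.
Proof.
case: k => [|[|[|[|//]]]] _; rewrite /dgbasis_coef /= ?expr1n //
  ?exprMn ?sqr_sqrtr //; by field.
Qed.

Lemma dgmassC k a : dgmass R k a = dgmass R a k.
Proof. by apply: eq_Rintegral => x _; rewrite mulrC. Qed.

Lemma Rintegral_dgbasis_fun k a (f g : R -> R) (c0 c1 c2 c3 c4 c5 c6 m : R) :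
  (forall x, f x * g x = c0 + c1 * x + c2 * x ^+ 2 + c3 * x ^+ 3 + c4 * x ^+ 4
                   + c5 * x ^+ 5 + c6 * x ^+ 6) ->
  c0 + c2 / 12 + c4 / 80 + c6 / 448 = m ->
  \int[lebesgue_measure]_(x in `[- 2^-1, 2^-1])
    ((dgbasis_coef k * f x) * (dgbasis_coef a * g x))
  = dgbasis_coef k * dgbasis_coef a * m.
Proof.
set C := _ * dgbasis_coef a => fgE <-.
rewrite (@Rintegral_sextic (C * c0) (C * c1) (C * c2) (C * c3) (C * c4)
  (C * c5) (C * c6)); first by field.
by move=> x; rewrite mulrACA fgE -/C; ring.
Qed.

Lemma dgmassE k a : (k < 4)%N -> (a < 4)%N -> dgmass R k a = (k == a)%:R.
Proof.
wlog ka : k a / (k <= a)%N.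
  move=> H hk ha; have [/H|/ltnW/H] := leqP k a; first exact.
  by rewrite dgmassC eq_sym; exact.
move=> hk ha; rewrite /dgmass.
under eq_Rintegral => x _ do rewrite (horner_dgbasis x hk) (horner_dgbasis x ha).
(* Each case is settled below by listing the coefficients of the product, from degree 0 to 6. *)
have off (c0 c1 c2 c3 c4 c5 c6 : R) : (forall x, dgbasis_fun k x * dgbasis_fun a x
    = c0 + c1 * x + c2 * x ^+ 2 + c3 * x ^+ 3 + c4 * x ^+ 4
      + c5 * x ^+ 5 + c6 * x ^+ 6) ->
    (k == a)%:R = dgbasis_coef k * dgbasis_coef a * (c0 + c2 / 12 + c4 / 80 + c6 / 448) ->
  \int[lebesgue_measure]_(x in `[- 2^-1, 2^-1])
    ((dgbasis_coef k * dgbasis_fun k x) * (dgbasis_coef a * dgbasis_fun a x))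
  = (k == a)%:R.
  by move=> fE ->; exact: (Rintegral_dgbasis_fun k a fE erefl).
(* On the diagonal the normalisation constant enters squared, hence as a rational number. *)
have diag m : (k < 4)%N -> (k == a) -> [:: 1; 12; 5 / 4; 7]`_k * m = 1 ->
    (k == a)%:R = dgbasis_coef k * dgbasis_coef a * m.
  by move=> k4 /eqP <- <-; rewrite eqxx -expr2 sqr_dgbasis_coef.
move: off diag; case: k hk ka => [|[|[|[|//]]]] _; case: a ha => [|[|[|[|//]]]] _ // _;
  cbv beta iota delta [nth dgbasis_fun] => off diag.
- apply: (off 1 0 0 0 0 0 0) => [x|]; first by ring.
  by apply: diag => //; field.
- by apply: (off 0 1 0 0 0 0 0) => [x|]; [ring|rewrite /=; field].
- by apply: (off (-1) 0 12 0 0 0 0) => [x|]; [ring|rewrite /=; field].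
- by apply: (off 0 (- 3) 0 20 0 0 0) => [x|]; [ring|rewrite /=; field].
- apply: (off 0 0 1 0 0 0 0) => [x|]; first by ring.
  by apply: diag => //; field.
- by apply: (off 0 (-1) 0 12 0 0 0) => [x|]; [ring|rewrite /=; field].
- by apply: (off 0 0 (- 3) 0 20 0 0) => [x|]; [ring|rewrite /=; field].
- apply: (off 1 0 (- 24) 0 144 0 0) => [x|]; first by ring.
  by apply: diag => //; field.
- by apply: (off 0 3 0 (- 56) 0 240 0) => [x|]; [ring|rewrite /=; field].
- apply: (off 0 0 9 0 (- 120) 0 400) => [x|]; first by ring.
  by apply: diag => //; field.
Qed.

Lemma dgstiffE k a : (k < 4)%N -> (a < 4)%N ->
  dgstiff R k a = \int[lebesgue_measure]_(x in `[- 2^-1, 2^-1])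
    ((dgbasis_coef k * dgbasis_dfun k x) * (dgbasis_coef a * dgbasis_fun a x)).
Proof.
move=> hk ha; apply: eq_Rintegral => x _.
by rewrite horner_deriv_dgbasis // horner_dgbasis.
Qed.

(** The derivative of b_k has degree below k <= a, and b_a is orthogonal to all lower degrees;
    checked here case by case. *)
Lemma dgstiff_eq0 k a : (k <= a)%N -> (a < 4)%N -> dgstiff R k a = 0.
Proof.
move=> ka a4; have k4 := leq_ltn_trans ka a4; rewrite dgstiffE //.
have off (c0 c1 c2 c3 c4 c5 c6 : R) : (forall x, dgbasis_dfun k x * dgbasis_fun a x
    = c0 + c1 * x + c2 * x ^+ 2 + c3 * x ^+ 3 + c4 * x ^+ 4
      + c5 * x ^+ 5 + c6 * x ^+ 6) ->
    c0 + c2 / 12 + c4 / 80 + c6 / 448 = 0 ->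
  \int[lebesgue_measure]_(x in `[- 2^-1, 2^-1])
    ((dgbasis_coef k * dgbasis_dfun k x) * (dgbasis_coef a * dgbasis_fun a x)) = 0.
  by move=> fE /(Rintegral_dgbasis_fun k a fE) ->; rewrite mulr0.
move: off; case: k k4 ka => [|[|[|[|//]]]] _; case: a a4 => [|[|[|[|//]]]] _ // _;
  cbv beta iota delta [nth dgbasis_fun dgbasis_dfun] => off.
1-4: by apply: (off 0 0 0 0 0 0 0) => [x|]; [ring|field].
- by apply: (off 0 1 0 0 0 0 0) => [x|]; [ring|field].
- by apply: (off (-1) 0 12 0 0 0 0) => [x|]; [ring|field].
- by apply: (off 0 (- 3) 0 20 0 0 0) => [x|]; [ring|field].
- by apply: (off 0 (- 24) 0 288 0 0 0) => [x|]; [ring|field].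
- by apply: (off 0 0 (- 72) 0 480 0 0) => [x|]; [ring|field].
- by apply: (off 0 9 0 (- 240) 0 1200 0) => [x|]; [ring|field].
Qed.

(** The derivative of b_(k+1) has degree exactly k, hence a nonzero component along b_k. *)
Lemma dgstiff_succ_neq0 k : (k < 3)%N -> dgstiff R k.+1 k != 0.
Proof.
move=> k3; rewrite dgstiffE //; last exact: ltnW.
have off (c0 c1 c2 c3 c4 c5 c6 : R) : (forall x, dgbasis_dfun k.+1 x * dgbasis_fun k x
    = c0 + c1 * x + c2 * x ^+ 2 + c3 * x ^+ 3 + c4 * x ^+ 4
      + c5 * x ^+ 5 + c6 * x ^+ 6) ->
    (* The right-hand side encodes the values 1, 2, 4 of the unnormalised integral for k = 0, 1,
       2. *)
    c0 + c2 / 12 + c4 / 80 + c6 / 448 = k.+1%:R + (k == 2)%:R ->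
  \int[lebesgue_measure]_(x in `[- 2^-1, 2^-1])
    ((dgbasis_coef k.+1 * dgbasis_dfun k.+1 x) * (dgbasis_coef k * dgbasis_fun k x)) != 0.
  move=> fE /(Rintegral_dgbasis_fun k.+1 k fE) ->.
  by rewrite -natrD !mulf_neq0 ?dgbasis_coef_neq0 ?pnatr_eq0 // ltnW.
move: off; case: k k3 => [|[|[|//]]] _;
  cbv beta iota delta [nth dgbasis_fun dgbasis_dfun] => off.
- by apply: (off 1 0 0 0 0 0 0) => [x|]; [ring|rewrite /=; field].
- by apply: (off 0 0 24 0 0 0 0) => [x|]; [ring|rewrite /=; field].
- by apply: (off 3 0 (- 96) 0 720 0 0) => [x|]; [ring|rewrite /=; field].
Qed.

(** The product rule. This identity is what makes the central part of the scheme skew-Hermitian. *)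
Lemma dgstiff_by_parts k a :
  dgstiff R k a + dgstiff R a k =
  (b k).[2^-1] * (b a).[2^-1] - (b k).[- 2^-1] * (b a).[- 2^-1].
Proof.
have ci p q : continuous (fun x : R => (p : {poly R}).[x] * (q : {poly R}).[x]).
  by move=> x; apply: cvgM; exact: continuous_horner.
rewrite -!hornerM -Rintegral_horner -RintegralD //;
  [|exact: continuous_integrable..].
by apply: eq_Rintegral => x _; rewrite derivM !hornerE [in RHS]addrC [X in _ + X]mulrC addrC.
Qed.

End Basis.

(** * Moments of a Fourier mode *)

Section Oscillatory.
Variable R : realType.
Notation C := R[i].
Implicit Types (a b c h : R) (p w : {poly R}) (f : R -> C) (z : C).

Lemma poly_primitive p : exists P : {poly R}, P^`() = p.
Proof.
exists (\poly_(i < (size p).+1) (p`_i.-1 / i%:R)).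
apply/polyP => i; rewrite coef_deriv coef_poly ltnS /=.
case: ltnP => [ip|pi]; last by rewrite mul0rn nth_default.
by rewrite -[LHS]mulr_natr mulfVK // pnatr_eq0.
Qed.

Lemma CintegralZl a b f z :
  continuous (fun x : R => complex.Re (f x)) -> continuous (fun x : R => complex.Im (f x)) ->
  Cintegral a b (fun x => z * f x) = z * Cintegral a b f.
Proof.
move=> cr ci; case: z => u v; rewrite /Cintegral.
have mi g (t : R) : continuous (g : R -> R) -> continuous (fun x : R => t * g x).
  by move=> cg x; apply: cvgM; [exact: cvg_cst|exact: cg].
have eRe x : complex.Re ((u +i* v) * f x) = u * complex.Re (f x) - v * complex.Im (f x).
  by case: (f x).
have eIm x : complex.Im ((u +i* v) * f x) = u * complex.Im (f x) + v * complex.Re (f x).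
  by case: (f x).
under eq_Rintegral do rewrite eRe.
under [X in _ +i* X]eq_Rintegral do rewrite eIm.
rewrite RintegralB ?RintegralD ?RintegralZl //;
  by apply: continuous_integrable => //; exact: mi.
Qed.

(** The one-dimensional factor of a degree of freedom on a cell of width [h], without its
    normalisation 1/h. *)
Definition osc_integral h c p : C :=
  Cintegral (- (h / 2)) (h / 2) (fun x => (p.[x / h])%:C * cexpi (c * x)).

Lemma Re_real_cexpi (u th : R) : complex.Re (u%:C * cexpi th) = u * cos th.
Proof. by rewrite /cexpi /= mul0r subr0. Qed.

Lemma Im_real_cexpi (u th : R) : complex.Im (u%:C * cexpi th) = u * sin th.
Proof. by rewrite /cexpi /= mul0r addr0. Qed.

Lemma continuous_Re_osc h c p :
  continuous (fun x : R => complex.Re ((p.[x / h])%:C * cexpi (c * x))).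
Proof.
under eq_fun do rewrite Re_real_cexpi.
by move=> x; apply: cvgM; [exact: continuous_horner_scale|exact: continuous_cos_scale].
Qed.

Lemma continuous_Im_osc h c p :
  continuous (fun x : R => complex.Im ((p.[x / h])%:C * cexpi (c * x))).
Proof.
under eq_fun do rewrite Im_real_cexpi.
by move=> x; apply: cvgM; [exact: continuous_horner_scale|exact: continuous_sin_scale].
Qed.

Lemma osc_integralZ h c (t : R) p :
  osc_integral h c (t *: p) = t%:C * osc_integral h c p.
Proof.
rewrite /osc_integral -CintegralZl; [|exact: continuous_Re_osc|exact: continuous_Im_osc].
by congr Cintegral; apply/funext => x; rewrite hornerZ mulrA -rmorphM.
Qed.

(** Integration by parts gives the factor - i c; the extra [h] arises because [p] is differentiated
    in the reference variable x / h. *)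
Lemma osc_integral_deriv h c p : 0 < h -> p.[2^-1] = 0 -> p.[- 2^-1] = 0 ->
  osc_integral h c p^`() = (0 +i* - (c * h)) * osc_integral h c p.
Proof.
move=> h0 p1 p2; have hN0 := lt0r_neq0 h0.
pose q := p \Po (h^-1 *: 'X).
have qE x : q.[x] = p.[x / h] by rewrite /q horner_comp hornerZ hornerX mulrC.
have dqE x : q^`().[x] = p^`().[x / h] / h.
  rewrite /q deriv_comp hornerM horner_comp derivZ derivX -polyC1 !hornerZ.
  by rewrite hornerX hornerC mulr1 [_ * x]mulrC.
have q1 : q.[h / 2] = 0 by rewrite qE mulrAC divff ?mul1r.
have q2 : q.[- (h / 2)] = 0 by rewrite qE mulNr mulrAC divff ?mul1r.
have ab : - (h / 2) < h / 2 by lra.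
have -> : osc_integral h c p^`() =
    h%:C * Cintegral (- (h / 2)) (h / 2) (fun x => (q^`().[x])%:C * cexpi (c * x)).
  rewrite /osc_integral -CintegralZl; last 2 first.
  - by have := @continuous_Re_osc 1 c q^`(); under eq_fun do rewrite divr1.
  - by have := @continuous_Im_osc 1 c q^`(); under eq_fun do rewrite divr1.
  congr Cintegral; apply/funext => x.
  by rewrite mulrA -rmorphM dqE [h * _]mulrC mulfVK.
have -> : osc_integral h c p =
    Cintegral (- (h / 2)) (h / 2) (fun x => (q.[x])%:C * cexpi (c * x)).
  by congr Cintegral; apply/funext => x; rewrite qE.
rewrite /Cintegral.
under eq_Rintegral do rewrite Re_real_cexpi.
under [X in _ * (_ +i* X) = _]eq_Rintegral do rewrite Im_real_cexpi.
under [X in _ = _ * (X +i* _)]eq_Rintegral do rewrite Re_real_cexpi.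
under [X in _ = _ * (_ +i* X)]eq_Rintegral do rewrite Im_real_cexpi.
rewrite Rintegral_deriv_cos // Rintegral_deriv_sin //.
by apply/eqP; rewrite eq_complex /=; apply/andP; split; apply/eqP; ring.
Qed.

(** Each differentiation uses up at most one factor [p]. *)
Lemma derivn_exp_factor p n j : (j <= n)%N ->
  exists r, (p ^+ n)^`(j) = p ^+ (n - j) * r.
Proof.
elim: j => [_|j ih jn]; first by exists 1; rewrite derivn0 subn0 mulr1.
have [r E] := ih (ltnW jn).
rewrite derivnS E derivM deriv_exp subnS.
case: (n - j)%N (subn_gt0 j n) jn => [|m] + jn; rewrite jn // => _ /=.
exists (p^`() *+ m.+1 * r + p * r^`()).
by rewrite mulrDr -mulrnAl exprSr; ring.
Qed.

End Oscillatory.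

(** * Rodrigues' formula *)

Section LowerBound.
Variable R : realType.
Implicit Types (a b c h : R) (p w : {poly R}).

Lemma osc_integral_derivn h c p n : 0 < h ->
  (forall j, (j < n)%N -> p^`(j).[2^-1] = 0 /\ p^`(j).[- 2^-1] = 0) ->
  osc_integral h c p^`(n) = (0 +i* - (c * h)) ^+ n * osc_integral h c p.
Proof.
move=> h0; elim: n => [|n ih] pn; first by rewrite derivn0 expr0 mul1r.
have [p1 p2] := pn n (ltnSn n).
rewrite derivnS osc_integral_deriv // ih ?exprS ?mulrA // => j jn.
by apply: pn; exact: ltnW.
Qed.

(** Vanishes at both ends of the reference cell and is positive in between: the generating weight of
    Rodrigues' formula on (-1/2, 1/2). *)
Definition bubble : {poly R} := (4^-1)%:P - 'X^2.

Lemma bubble_exp_derivn_bnd k j : (j < k)%N ->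
  (bubble ^+ k)^`(j).[2^-1] = 0 /\ (bubble ^+ k)^`(j).[- 2^-1] = 0.
Proof.
move=> jk; have [r ->] := derivn_exp_factor bubble (ltnW jk).
have b0 x : x ^+ 2 = 4^-1 -> (bubble ^+ (k - j)).[x] = 0.
  move=> xE; rewrite horner_exp hornerD hornerN hornerXn hornerC xE subrr.
  by rewrite expr0n subn_eq0 leqNgt jk.
by rewrite !hornerM !b0 ?mul0r //; field.
Qed.

(** The k-th derivatives of (1/4 - x^2)^k for k = 0, 1, 2, 3 are 1, - 2x, 12x^2 - 1 and - 6 (20x^3 -
    3x); comparison with the basis gives [e]. *)
Lemma dgbasis_rodrigues k : (k < 4)%N ->
  exists2 e : R, e != 0 & dgbasis R k = e *: (bubble ^+ k)^`(k).
Proof.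
have dbub : bubble^`() = - ('X *+ 2).
  by rewrite derivB derivC derivXn sub0r.
have E4 : 4 * (4^-1)%:P = 1 :> {poly R}.
  by rewrite -[4 : {poly R}]polyC_natr -polyCM divff ?pnatr_eq0.
have dc := @dgbasis_coef_neq0 R.
case: k => [|[|[|[|//]]]] k4.
- by exists 1; rewrite ?oner_neq0 // scale1r.
- exists (- (Num.sqrt 3)); first by rewrite oppr_eq0 gt_eqF // sqrtr_gt0.
  rewrite derivn1 expr1 dbub scalerN scaleNr opprK -['X *+ 2]scaler_nat scalerA.
  by rewrite [_ * 2]mulrC.
- exists (Num.sqrt 5 / 2); first exact: (dc 2).
  congr (_ *: _); rewrite expr2 !derivnS derivn0 derivM dbub.
  rewrite !(derivD, derivM, derivN, derivMn, derivX) ?dbub -mul_polyC /bubble ?derivC.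
  have -> : (12%:P : {poly R}) = 12 by rewrite polyC_natr.
  rewrite -[X in _ - X]E4; ring.
- exists (- Num.sqrt 7 / 6).
    by rewrite mulf_neq0 ?invr_neq0 ?pnatr_eq0 // oppr_eq0; exact: (dc 3).
  have E12 : 3%:P = 12 * (4^-1)%:P :> {poly R}.
    by rewrite -polyC_natr -polyCM; congr polyC; field.
  have -> : (bubble ^+ 3)^`(3) = (- 6) *: ('X * (20 *: 'X^2 - 3%:P)).
    rewrite E12.
    rewrite !exprS expr0 mulr1 !derivnS derivn0.
    do 3 rewrite ?(derivD, derivM, derivN, derivMn, derivX) ?dbub -?polyC1 ?derivC.
    rewrite -!mul_polyC /bubble !(polyCN, polyC_natr, polyC1).
      ring.
  by rewrite scalerA; congr (_ *: _); field.
Qed.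

Lemma bubble_exp_integral_gt0 k : (k < 4)%N ->
  0 < \int[lebesgue_measure]_(x in `[- 2^-1, 2^-1]) (bubble ^+ k).[x].
Proof.
have bE x : bubble.[x] = 4^-1 - x ^+ 2 by rewrite hornerD hornerN hornerXn hornerC.
case: k => [|[|[|[|//]]]] _.
- rewrite (@Rintegral_sextic _ 1 0 0 0 0 0 0) => [|x]; first lra.
  by rewrite horner_exp; ring.
- rewrite (@Rintegral_sextic _ (1/4) 0 (-1) 0 0 0 0) => [|x]; first lra.
  by rewrite horner_exp bE; field.
- rewrite (@Rintegral_sextic _ (1/16) 0 (- (1/2)) 0 1 0 0) => [|x]; first lra.
  by rewrite horner_exp bE; field.
- rewrite (@Rintegral_sextic _ (1/64) 0 (- (3/16)) 0 (3/4) 0 (-1)) => [|x]; first lra.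
  by rewrite horner_exp bE; field.
Qed.

End LowerBound.

(** * Lower bounds for oscillatory moments and for the degree of freedom (0, K) *)

Section DofLowerBound.
Variable R : realType.
Implicit Types (a b c h : R) (p w : {poly R}).

Lemma Re_le_normc (z : R[i]) : complex.Re z <= Normc.normc z.
Proof.
have := normc_ge_Re z; rewrite -lecR.
by apply: le_trans; rewrite lecR ler_norm.
Qed.

Lemma near_right_lt (e : R) : 0 < e -> \forall h \near 0^'+, 0 < h < e.
Proof.
move=> e0; near=> h; apply/andP; split; near: h.
  exact: nbhs_right_gt.
exact: nbhs_right_lt.
Unshelve. all: by end_near. Qed.

(** On a small cell the phase stays close to 0, where the cosine is close to 1; this rules out
    cancellation in the moments. *)
Lemma near_cos_ge_half c :
  \forall h \near 0^'+, forall x, `|x| <= h / 2 -> 2^-1 <= cos (c * x).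
Proof.
have /cvgrPdist_lt /(_ 2^-1) : cos @ (0 : R) --> cos (0 : R) by exact: continuous_cos.
rewrite invr_gt0 ltr0n cos0 => /(_ isT) /nbhs_ballP [d /= d0 hd].
have c1 : 0 < `|c| + 1 by rewrite ltr_wpDl.
apply: filterS (near_right_lt (divr_gt0 d0 c1)) => h /andP[h0 hlt] x xh.
(* The bound on [h] divides by |c| + 1 rather than |c|, which is positive even for c = 0. *)
have /hd : ball (0 : R) d (c * x).
  rewrite /ball /= sub0r normrN normrM.
  rewrite ltr_pdivlMr // in hlt; apply: le_lt_trans hlt.
  rewrite mulrC ler_pM // ?lerDl //; apply: le_trans xh _; lra.
by rewrite ltr_distl => /andP[_] /ltW; lra.
Qed.

Lemma osc_integral_lower w :
  (forall x, `|x| <= 2^-1 -> 0 <= w.[x]) ->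
  0 < \int[lebesgue_measure]_(x in `[- 2^-1, 2^-1]) w.[x] ->
  forall c, exists2 m : R, 0 < m &
    \forall h \near 0^'+, m * h <= Normc.normc (osc_integral h c w).
Proof.
(* The factor 1/2 is the lower bound of the cosine; the real part alone already gives the
   estimate. *)
move=> w0 iw c; exists (2^-1 * \int[lebesgue_measure]_(x in `[- 2^-1, 2^-1]) w.[x]).
  by rewrite mulr_gt0.
apply: filterS2 (near_cos_ge_half c) (near_right_lt ltr01) => h hc /andP[h0 _].
apply: le_trans (Re_le_normc _).
(* Writing [w] as a derivative lets the integrals over the cell and over the reference cell be
   compared through the same end values. *)
have [P PE] := poly_primitive w.
have -> : (2^-1 * \int[lebesgue_measure]_(x in `[- 2^-1, 2^-1]) w.[x]) * h =
    \int[lebesgue_measure]_(x in `[- (h / 2), h / 2]) (2^-1 * w.[x / h]).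
  rewrite RintegralZl //; last by apply: continuous_integrable; exact: continuous_horner_scale.
  by rewrite -PE Rintegral_horner Rintegral_horner_scale // -mulrA [_ * h]mulrC.
have -> : complex.Re (osc_integral h c w) =
    \int[lebesgue_measure]_(x in `[- (h / 2), h / 2]) (w.[x / h] * cos (c * x)).
  by apply: eq_Rintegral => x _; rewrite Re_real_cexpi.
apply: le_Rintegral => //.
- apply: continuous_integrable => x; apply: cvgM; first exact: cvg_cst.
  exact: continuous_horner_scale.
- apply: continuous_integrable => x.
  apply: cvgM; [exact: continuous_horner_scale|exact: continuous_cos_scale].
- move=> x /=; rewrite in_itv /= -ler_norml => xh; rewrite [leRHS]mulrC.
  apply: ler_wpM2r (hc x xh); apply: w0.
  by rewrite normrM normfV [`|h|]gtr0_norm // ler_pdivrMr // mulrC.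
Qed.

Lemma normc_real_mul (r : R) z : Normc.normc (r%:C * z) = `|r| * Normc.normc z.
Proof. by rewrite Normc.normcM /= expr0n addr0 sqrtr_sqr. Qed.

(** By Rodrigues' formula, k integrations by parts extract (c h)^k in modulus; what remains is the
    moment of a nonnegative weight, of size at least a constant times h. *)
Lemma osc_dgbasis_lower k c : (k < 4)%N -> c != 0 ->
  exists2 m : R, 0 < m &
    \forall h \near 0^'+, m * h ^+ k.+1 <= Normc.normc (osc_integral h c (dgbasis R k)).
Proof.
move=> k4 c0; have [e e0 bE] := dgbasis_rodrigues R k4.
have wpos x : `|x| <= 2^-1 -> 0 <= (bubble R ^+ k).[x].
  move=> xh; rewrite horner_exp exprn_ge0 // /bubble hornerD hornerN hornerXn hornerC.
  rewrite subr_ge0 -real_normK ?num_real //.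
  have -> : 4^-1 = 2^-1 ^+ 2 :> R by field.
  by rewrite lerXn2r ?nnegrE.
have [m m0 hm] := osc_integral_lower wpos (bubble_exp_integral_gt0 R k4) c.
(* The factors come from Rodrigues' constant, the integrations by parts and the moment of the
   bubble. *)
exists (`|e| * `|c| ^+ k * m); first by rewrite !mulr_gt0 ?exprn_gt0 ?normr_gt0.
apply: filterS2 hm (near_right_lt ltr01) => h hm /andP[h0 _].
rewrite bE osc_integralZ normc_real_mul osc_integral_derivn //; last first.
  by move=> j; exact: bubble_exp_derivn_bnd.
have normX z n : Normc.normc (z ^+ n) = Normc.normc z ^+ n :> R.
  by elim: n => [|n ih]; rewrite ?expr0 ?Normc.normc1 // !exprS Normc.normcM ih.
rewrite Normc.normcM normX /= expr0n add0r sqrtr_sqr normrN normrM (gtr0_norm h0).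
rewrite exprMn exprSr -!mulrA ler_wpM2l // ler_wpM2l ?exprn_ge0 //.
by rewrite mulrCA ler_wpM2l ?exprn_ge0 // ltW.
Qed.

Variable K : nat.

Lemma DOFE (kx ky h : R) (Q : 'cV[R[i]]_3) (k l : 'I_K.+1) (c : 'I_3) :
  DOF K kx ky h h Q (enum_rank (k, l, c)) 0 =
  Q c 0 * ((h * h)^-1)%:C * (osc_integral h kx (dgbasis R k) * osc_integral h ky (dgbasis R l)).
Proof.
rewrite mxE enum_rankK; congr (_ * _).
rewrite [RHS]mulrC -CintegralZl; [|exact: continuous_Re_osc|exact: continuous_Im_osc].
congr Cintegral; apply/funext => x.
rewrite [RHS]mulrC -CintegralZl; [|exact: continuous_Re_osc|exact: continuous_Im_osc].
by congr Cintegral; apply/funext => y; ring.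
Qed.

(** The two moments contribute h and h^(K+1), the cell area h^(-2), which leaves h^K; the amplitude
    of u is - [ky], which is nonzero. *)
Lemma DOF_lower (kx ky : R) : (K < 4)%N -> kx != 0 -> ky != 0 ->
  exists2 m : R, 0 < m & \forall h \near 0^'+,
    m * h ^+ K <= Normc.normc (DOF K kx ky h h (Qhat kx ky) (enum_rank (ord0, ord_max, ord0)) 0).
Proof.
move=> K4 kx0 ky0.
have [m1 m10 h1] := @osc_dgbasis_lower 0 kx isT kx0.
have [m2 m20 h2] := osc_dgbasis_lower K4 ky0.
exists (`|ky| * (m1 * m2)); first by rewrite !mulr_gt0 ?normr_gt0.
apply: filterS3 h1 h2 (near_right_lt ltr01) => h h1 h2 /andP[h0 _].
have QE : Qhat kx ky ord0 0 = (- ky)%:C by rewrite mxE.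
rewrite DOFE QE -mulrA normc_real_mul normrN -!mulrA ler_wpM2l //.
rewrite normc_real_mul Normc.normcM gtr0_norm ?invr_gt0 ?mulr_gt0 //.
rewrite [leRHS]mulrC ler_pdivlMr ?mulr_gt0 //.
have [m1' m2' h0'] : [/\ 0 <= m1, 0 <= m2 & 0 <= h] by rewrite !ltW.
rewrite (_ : _ * (h * h) = (m1 * h ^+ 1) * (m2 * h ^+ K.+1)).
  by rewrite ler_pM // mulr_ge0 ?exprn_ge0.
by rewrite expr1 exprS; ring.
Qed.

End DofLowerBound.

(** * The energy argument *)

Section Energy.
Variables (F : numClosedFieldType) (n : nat).
Local Notation "X ^H" := (map_mx Num.conj X^T) (at level 8, format "X ^H").
Implicit Types (A X Y u v p : 'M[F]_n) (r : 'rV[F]_n).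

Lemma adjmxM m1 m2 m3 (X : 'M[F]_(m1, m2)) (Y : 'M[F]_(m2, m3)) :
  (X *m Y)^H = Y^H *m X^H.
Proof. by rewrite trmx_mul map_mxM. Qed.

Lemma adjmxK m1 m2 (X : 'M[F]_(m1, m2)) : X^H^H = X.
Proof. by apply/matrixP => i j; rewrite !mxE conjCK. Qed.

Lemma mxtrace_adj (X : 'M[F]_n) : \tr X^H = Num.conj (\tr X).
Proof. by rewrite trace_map_mx mxtrace_tr. Qed.

(** The trace is the sum of the squared moduli of the entries. *)
Lemma mxtrace_gram_ge0 m1 m2 (X : 'M[F]_(m1, m2)) : 0 <= \tr (X^H *m X).
Proof.
apply: sumr_ge0 => i _; rewrite mxE; apply: sumr_ge0 => j _.
by rewrite !mxE mulrC mul_conjC_ge0.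
Qed.

Lemma mxtrace_gram_eq0 m1 m2 (X : 'M[F]_(m1, m2)) : \tr (X^H *m X) = 0 -> X = 0.
Proof.
have ge0 i : 0 <= (X^H *m X) i i.
  by rewrite mxE; apply: sumr_ge0 => j _; rewrite !mxE mulrC mul_conjC_ge0.
move=> /psumr_eq0P X0; apply/matrixP => i j; rewrite mxE.
have /psumr_eq0P /(_ i isT) : \sum_k X^H j k * X k j = 0.
  by have := X0 (fun i _ => ge0 i) j isT; rewrite mxE.
rewrite !mxE mulrC => H; apply/eqP; rewrite -mul_conjC_eq0; apply/eqP; apply: H.
by move=> k _; rewrite !mxE mulrC mul_conjC_ge0.
Qed.

(* Testing the three equations with u, v, p leaves, in the real part, only the
   dissipation of the upwind flux, a sum of squares of jumps. *)
Lemma upwind_jumps_vanish (Ax Ay u v p : 'M[F]_n) (jx jy : 'rV[F]_n) :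
  Ax^H = - Ax -> Ay^H = - Ay ->
  Ax *m p + (jx^H *m jx) *m u = 0 ->
  p *m Ay^T + v *m (jy^H *m jy)^T = 0 ->
  Ax *m u + (jx^H *m jx) *m p + v *m Ay^T + p *m (jy^H *m jy)^T = 0 ->
  [/\ jx *m u = 0, jx *m p = 0, jy *m v^T = 0 & jy *m p^T = 0].
Proof.
move=> hAx hAy e1 e2 e3.
(* Skew-Hermitian coupling: the two cross terms are negative conjugates of each other, so they
   cancel in the real part. *)
have skx (X Y : 'M[F]_n) : \tr (X^H *m (Ax *m Y)) = - Num.conj (\tr (Y^H *m (Ax *m X))).
  by rewrite -mxtrace_adj !adjmxM adjmxK hAx mulmxN mulNmx [\tr (- _)]raddfN opprK mulmxA.
have sky (X Y : 'M[F]_n) : \tr (X^H *m (Y *m Ay^T)) = - Num.conj (\tr (Y^H *m (X *m Ay^T))).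
  rewrite -mxtrace_adj !adjmxM adjmxK.
  have -> : Ay^T^H = - Ay^T.
    by apply/matrixP => i j; have /matrixP/(_ j i) := hAy; rewrite !mxE.
  by rewrite !mulNmx [\tr (- _)]raddfN opprK -mulmxA [RHS]mxtrace_mulC mulmxA.
have gx (X : 'M[F]_n) : \tr (X^H *m (jx^H *m jx *m X)) = \tr ((jx *m X)^H *m (jx *m X)).
  by rewrite adjmxM !mulmxA.
have gy (X : 'M[F]_n) : \tr (X^H *m (X *m (jy^H *m jy)^T))
    = \tr ((jy *m X^T)^H *m (jy *m X^T)).
  have XE : (X^H)^T = (X^T)^H by apply/matrixP => i j; rewrite !mxE.
  rewrite adjmxM -mxtrace_tr trmx_mul [(X *m _)^T]trmx_mul XE !trmxK.
  by rewrite mxtrace_mulC !mulmxA.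
have t1 : \tr (u^H *m (Ax *m p)) + \tr (u^H *m (jx^H *m jx *m u)) = 0.
  by rewrite -mxtraceD -mulmxDr e1 mulmx0 mxtrace0.
have t2 : \tr (v^H *m (p *m Ay^T)) + \tr (v^H *m (v *m (jy^H *m jy)^T)) = 0.
  by rewrite -mxtraceD -mulmxDr e2 mulmx0 mxtrace0.
have t3 : \tr (p^H *m (Ax *m u)) + \tr (p^H *m (jx^H *m jx *m p))
   + \tr (p^H *m (v *m Ay^T)) + \tr (p^H *m (p *m (jy^H *m jy)^T)) = 0.
  by rewrite -!mxtraceD -!mulmxDr e3 mulmx0 mxtrace0.
rewrite (skx u) in t1; rewrite (sky v) in t2; rewrite !gx !gy in t1 t2 t3.
have [g1 g2 g3 g4] : [/\ 0 <= \tr ((jx *m u)^H *m (jx *m u)),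
  0 <= \tr ((jx *m p)^H *m (jx *m p)), 0 <= \tr ((jy *m v^T)^H *m (jy *m v^T))
  & 0 <= \tr ((jy *m p^T)^H *m (jy *m p^T))] by split; exact: mxtrace_gram_ge0.
have := @mxtrace_gram_eq0 _ _ (jx *m u).
have := @mxtrace_gram_eq0 _ _ (jx *m p).
have := @mxtrace_gram_eq0 _ _ (jy *m v^T).
have := @mxtrace_gram_eq0 _ _ (jy *m p^T).
move: g1 g2 g3 g4 t1 t2 t3.
move: (\tr ((jx *m u)^H *m _)) (\tr ((jx *m p)^H *m _)) (\tr ((jy *m v^T)^H *m _)).
move: (\tr ((jy *m p^T)^H *m _)) (\tr (p^H *m (Ax *m u))) (\tr (p^H *m (v *m Ay^T))).
move=> d a b x y z g1 g2 g3 g4 t1 t2 t3 ed ez ey ex.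
(* The first two tested equations identify the conjugates of the cross terms [a], [b] with the jump
   terms [x], [z]. These are real, so the third equation becomes x + y + z + d = 0 with four
   nonnegative terms. *)
have xE : x = Num.conj a by apply/eqP; rewrite -subr_eq0 addrC; apply/eqP.
have zE : z = Num.conj b by apply/eqP; rewrite -subr_eq0 addrC; apply/eqP.
have aE : a = x by rewrite -[LHS]conjCK -xE conj_Creal // ger0_real.
have bE : b = z by rewrite -[LHS]conjCK -zE conj_Creal // ger0_real.
move: t3; rewrite aE bE => /eqP.
rewrite !paddr_eq0 ?addr_ge0 // => /andP[/andP[/andP[/eqP x0 /eqP y0] /eqP z0] /eqP d0].
by split; [exact: ex|exact: ey|exact: ez|exact: ed].
Qed.

End Energy.

(** * The kernel of the evolution matrix *)

Section Kernel.
Variables (R : realType) (K : nat).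
Hypothesis K4 : (K < 4)%N.
Notation C := R[i].
Local Notation n := K.+1.
Local Notation bR k := ((dgbasis R k).[2^-1])%:C.
Local Notation bL k := ((dgbasis R k).[- 2^-1])%:C.
Local Notation G k a := (dgstiff R k a)%:C.
Local Notation "X ^H" := (map_mx Num.conj X^T) (at level 8, format "X ^H").
Implicit Types (t : C) (q : 'cV[C]_(ndof K)) (c d : 'I_3).

Lemma conj_real_complex (r : R) : Num.conj (r%:C) = r%:C.
Proof. exact: conjc_real. Qed.

Lemma cexpi_conj (th : R) : cexpi th * Num.conj (cexpi th) = 1.
Proof.
have -> : Num.conj (cexpi th) = cos th +i* - sin th by [].
apply/eqP; rewrite eq_complex /=; apply/andP; split; apply/eqP; last by ring.
by rewrite -(cos2Dsin2 th); ring.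
Qed.

(** The jump at the right face of a cell: the trace from the neighbour, which carries the multiplier
    [t], minus the trace from the cell itself. *)
Definition jump_row t : 'rV[C]_n := \row_a (t * bL a - bR a).

(** Volume term and central flux of one space direction, scaled by 2h; the conjugate of [t] stands
    for 1/t, since |t| = 1. *)
Definition central_mx t : 'M[C]_n := \matrix_(k, a)
  (- (2 * G k a) + (bR k - Num.conj t * bL k) * (bR a + t * bL a)).

Definition stiff_mx : 'M[C]_n := \matrix_(k, a) G k a.

Lemma stiff_by_parts k a : G k a + G a k = bR k * bR a - bL k * bL a :> C.
Proof. by rewrite -!rmorphM -rmorphB -rmorphD dgstiff_by_parts. Qed.

Lemma central_mx_adj t : t * Num.conj t = 1 -> (central_mx t)^H = - central_mx t.
Proof.
move=> tt; apply/matrixP => k a; rewrite !mxE.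
rewrite !(rmorphD, rmorphN, rmorphM) /= conjCK !conj_real_complex rmorph1.
have -> : G a k = bR k * bR a - bL k * bL a - G k a.
  by rewrite -stiff_by_parts; ring.
ring: tt.
Qed.

(** Undoing the integration by parts turns the weak derivative into the strong one, given by the
    transposed stiffness matrix; the boundary terms left over are a multiple of the jump. *)
Lemma central_mxE t : t * Num.conj t = 1 ->
  central_mx t = 2 *: stiff_mx^T + (\col_k (bR k + Num.conj t * bL k)) *m jump_row t.
Proof.
move=> tt; apply/matrixP => k a; rewrite !mxE big_ord1 !mxE.
have -> : G k a = bR k * bR a - bL k * bL a - G a k.
  by rewrite -stiff_by_parts; ring.
ring: tt.
Qed.

Lemma jump_gramE t k a : ((jump_row t)^H *m jump_row t) k a =
  (Num.conj t * bL k - bR k) * (t * bL a - bR a).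
Proof.
by rewrite mxE big_ord1 !mxE !(rmorphD, rmorphN, rmorphM) /= !conj_real_complex.
Qed.

(** Rows carry the x-degree and columns the y-degree, so x-operators multiply on the left and
    transposed y-operators on the right. *)
Definition component c q : 'M[C]_n := \matrix_(i, j) q (enum_rank (i, j, c)) 0.

(** Splits each direction into a skew-Hermitian central part and a dissipative part, the latter
    being the Gram matrix of the jump; the mass matrix is the identity. *)
Lemma evolution_blockE (Dx Dy : 'M[C]_3) (kx ky h : R) (k l a b : 'I_n) c d : 0 < h ->
  let tx := cexpi (kx * h) in let ty := cexpi (ky * h) in
  evolution_block Dx Dy kx ky h h k l a b c d = (2 * h%:C)^-1 *
   ((l == b)%:R * (central_mx tx k a * Jx R c d
                   + ((jump_row tx)^H *m jump_row tx) k a * Dx c d)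
    + (k == a)%:R * (central_mx ty l b * Jy R c d
                   + ((jump_row ty)^H *m jump_row ty) l b * Dy c d)).
Proof.
move=> h0 tx ty; rewrite /evolution_block -/tx -/ty.
have n4 (i : 'I_n) : (i < 4)%N by apply: leq_trans (ltn_ord i) _.
rewrite !dgmassE //.
have hN0 : h%:C != 0 :> C by rewrite -(rmorph0 (real_complex R)) (inj_eq (@complexI R)) gt_eqF.
have conjE (th : R) : cexpi th * Num.conj (cexpi th) = 1 := cexpi_conj th.
have tN0 (th : R) : cexpi th != 0.
  apply/eqP => t0; have := conjE th; rewrite t0 mul0r => /eqP.
  by rewrite eq_sym oner_eq0.
have divE (th : R) (x y : C) : (x * cexpi th - y) / (cexpi th * h%:C)
    = (x - Num.conj (cexpi th) * y) / h%:C.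
  have -> : x * cexpi th - y = cexpi th * (x - Num.conj (cexpi th) * y).
    by rewrite mulrBr mulrA conjE; ring.
  by field; rewrite hN0 tN0.
rewrite !divE -/tx -/ty !jump_gramE !mxE.
by field.
Qed.

Lemma sum_delta (i : 'I_n) (f : 'I_n -> C) : \sum_(j < n) (i == j :> nat)%:R * f j = f i.
Proof.
rewrite (bigD1 i) //= eqxx mul1r big1 ?addr0 // => j ji.
by rewrite val_eqE eq_sym (negbTE ji) mul0r.
Qed.

Lemma sum_dof_index (f : dof_index K -> C) :
  \sum_s f s = \sum_a \sum_b \sum_c f (a, b, c).
Proof.
rewrite pair_bigA pair_bigA /=.
by apply: eq_bigr => -[[a b] c].
Qed.

Lemma evolution_mulE (Dx Dy : 'M[C]_3) (kx ky h : R) q c : 0 < h ->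
  let tx := cexpi (kx * h) in let ty := cexpi (ky * h) in
  evolution K Dx Dy kx ky h h *m q = 0 ->
  \sum_d (Jx R c d *: (central_mx tx *m component d q)
          + Dx c d *: ((jump_row tx)^H *m jump_row tx *m component d q)
          + Jy R c d *: (component d q *m (central_mx ty)^T)
          + Dy c d *: (component d q *m ((jump_row ty)^H *m jump_row ty)^T)) = 0.
Proof.
move=> h0 tx ty Eq; apply/matrixP => k l.
have hN0 : 2 * h%:C != 0 :> C.
  by rewrite mulf_neq0 ?pnatr_eq0 // -(rmorph0 (real_complex R)) (inj_eq (@complexI R)) gt_eqF.
have /matrixP/(_ (enum_rank (k, l, c)) 0) := Eq.
rewrite mxE (reindex enum_rank) /=; last exact: onW_bij (enum_rank_bij _).
rewrite sum_dof_index [X in _ = X -> _]mxE => E0.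
have {E0} : \sum_(a < n) \sum_(b < n) \sum_d
   ((l == b :> nat)%:R * ((central_mx tx k a * Jx R c d
                   + ((jump_row tx)^H *m jump_row tx) k a * Dx c d) * component d q a b)
    + (k == a :> nat)%:R * ((central_mx ty l b * Jy R c d
                   + ((jump_row ty)^H *m jump_row ty) l b * Dy c d) * component d q a b)) = 0.
  move/(congr1 ( *%R (2 * h%:C))): E0; rewrite mulr0 => E0; apply: etrans E0.
  rewrite big_distrr /=; apply: eq_bigr => a _.
  rewrite big_distrr /=; apply: eq_bigr => b _.
  rewrite big_distrr /=; apply: eq_bigr => d _.
  rewrite [evolution _ _ _ _ _ _ _ _ _]mxE !enum_rankK evolution_blockE // !mulrA mulfV // mul1r.
  by rewrite [component _ _ _ _]mxE; ring.
rewrite [X in _ -> _ = X]mxE => <-.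
under [RHS]eq_bigr => a _ do rewrite exchange_big.
rewrite [RHS]exchange_big /= summxE; apply: eq_bigr => d _.
under [RHS]eq_bigr => a _ do rewrite big_split /= sum_delta -big_distrr /=.
rewrite [RHS]big_split /= sum_delta.
move: ((jump_row tx)^H *m jump_row tx) ((jump_row ty)^H *m jump_row ty) => Bx By.
rewrite !mxE !big_distrr /= -!big_split /=.
by apply: eq_bigr => a _; rewrite ?mxE; ring.
Qed.

End Kernel.

(** * Consequences of the upwind flux: continuity, zero divergence and the vanishing mode (0, K) *)

Section KernelTop.
Variables (R : realType) (K : nat).
Hypothesis K4 : (K < 4)%N.
Notation C := R[i].
Local Notation n := K.+1.
Local Notation "X ^H" := (map_mx Num.conj X^T) (at level 8, format "X ^H").

Let c0 : 'I_3 := Ordinal (isT : 0 < 3)%N.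
Let c1 : 'I_3 := Ordinal (isT : 1 < 3)%N.
Let c2 : 'I_3 := Ordinal (isT : 2 < 3)%N.

Lemma sum_ord3 (V : zmodType) (f : 'I_3 -> V) : \sum_d f d = f c0 + f c1 + f c2.
Proof.
rewrite !big_ord_recl big_ord0 addr0 addrA.
by congr (f _ + f _ + f _); apply: val_inj.
Qed.

Lemma JxE (c d : 'I_3) : Jx R c d = ((c + d == 2)%N && (c != 1 :> nat))%:R.
Proof. by rewrite mxE; case: c d => [[|[|[|//]]] ?] [[|[|[|//]]] ?]. Qed.

Lemma JyE (c d : 'I_3) : Jy R c d = (c + d == 3)%N%:R.
Proof. by rewrite mxE; case: c d => [[|[|[|//]]] ?] [[|[|[|//]]] ?]. Qed.

Lemma Dx_upwindE (c d : 'I_3) : Dx_upwind R c d = ((c == d) && (c != 1 :> nat))%:R.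
Proof.
by rewrite !mxE; case: c d => [[|[|[|//]]] ?] [[|[|[|//]]] ?]; done.
Qed.

Lemma Dy_upwindE (c d : 'I_3) : Dy_upwind R c d = ((c == d) && (c != 0 :> nat))%:R.
Proof.
by rewrite !mxE; case: c d => [[|[|[|//]]] ?] [[|[|[|//]]] ?]; done.
Qed.

(** [X], [Y] are the central and dissipative terms in x, and [Z], [W] those in y; the three
    conclusions are the equations for u, v and p. *)
Lemma upwind_components (V : lmodType C) (X Y Z W : 'I_3 -> V) :
  (forall c, \sum_d (Jx R c d *: X d + Dx_upwind R c d *: Y d
     + Jy R c d *: Z d + Dy_upwind R c d *: W d) = 0) ->
  [/\ X c2 + Y c0 = 0, Z c2 + W c1 = 0 & X c0 + Y c2 + Z c1 + W c2 = 0].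
Proof.
move=> e; move: (e c0) (e c1) (e c2).
rewrite !sum_ord3 !JxE !JyE !Dx_upwindE !Dy_upwindE /=.
rewrite !(mulr1n, mulr0n, scale0r, scale1r, add0r, addr0) => e0 e1 e2.
split; first (by rewrite addrC); first by rewrite addrC.
by rewrite [X c0 + _ + _]addrAC -[LHS]addrA.
Qed.

Lemma evolution_kernel_jumps (kx ky h : R) (q : 'cV[C]_(ndof K)) : 0 < h ->
  evolution K (Dx_upwind R) (Dy_upwind R) kx ky h h *m q = 0 ->
  let u := component ord0 q in let v := component c1 q in
  [/\ jump_row K (cexpi (kx * h)) *m u = 0,
      jump_row K (cexpi (ky * h)) *m v^T = 0 &
      (stiff_mx R K)^T *m u + v *m stiff_mx R K = 0].
Proof.
move=> h0 Eq u v; pose p := component c2 q.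
set tx := cexpi (kx * h); set ty := cexpi (ky * h).
have tx1 : tx * Num.conj tx = 1 := cexpi_conj _.
have ty1 : ty * Num.conj ty = 1 := cexpi_conj _.
have e c := evolution_mulE K4 c h0 Eq.
have uE : component c0 q = u by congr component; apply: val_inj.
have [] := upwind_components e; rewrite -/tx -/ty uE -/v -/p => e0 e1 e2.
have [ju jp jv jpy] := upwind_jumps_vanish (central_mx_adj K tx1) (central_mx_adj K ty1)
  e0 e1 e2.
split; [exact: ju|exact: jv|move: e2].
have jt (M : 'M[C]_n) : jump_row K ty *m M^T = 0 -> M *m (jump_row K ty)^T = 0.
  by move=> jM; apply: trmx_inj; rewrite trmx_mul trmxK jM trmx0.
(* The pressure has no jumps, so both dissipative terms leave its equation. *)
rewrite -!mulmxA jp mulmx0 addr0 [(_^H *m _)^T]trmx_mul [p *m _]mulmxA (jt _ jpy) mul0mx addr0.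
(* Since u has no x-jump and v no y-jump, the central operators reduce to strong derivatives. *)
rewrite (central_mxE K tx1) (central_mxE K ty1) mulmxDl -scalemxAl -mulmxA ju mulmx0 addr0.
rewrite linearD linearZ /= trmxK trmx_mul mulmxDr [v *m (_ *m _)]mulmxA (jt _ jv) mul0mx addr0.
rewrite -scalemxAr -scalerDr => /eqP; rewrite scaler_eq0 pnatr_eq0 /=.
exact: eqP.
Qed.

Lemma evolution_kernel_top (kx ky h : R) (q : 'cV[C]_(ndof K)) : 0 < h ->
  cexpi (kx * h) != 1 ->
  evolution K (Dx_upwind R) (Dy_upwind R) kx ky h h *m q = 0 ->
  q (enum_rank (ord0, ord_max, ord0)) 0 = 0.
Proof.
move=> h0 t1 /(evolution_kernel_jumps h0).
set u := component ord0 q; set v := component _ q => -[ju _ div].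
have n4 (i : 'I_n) : (i < 4)%N by apply: leq_trans (ltn_ord i) _.
(* In the top y-degree the divergence equation reduces to the x-derivative of u. *)
have divK (k : 'I_n) : \sum_(a < n) (dgstiff R a k)%:C * u a ord_max = 0.
  have /matrixP/(_ k ord_max) := div; rewrite [LHS]mxE [RHS]mxE.
  have -> : (v *m stiff_mx R K) k ord_max = 0.
    rewrite mxE big1 // => b _; rewrite [stiff_mx R K _ _]mxE dgstiff_eq0 ?rmorph0 ?mulr0 //.
    by rewrite -ltnS ltn_ord.
  by rewrite addr0 mxE => E; apply: etrans E; apply: eq_bigr => a _; rewrite !mxE.
(* Descending induction on the x-degree [a], testing with degree a - 1: higher modes vanish by
   induction, lower ones have zero stiffness entry, and the entry of [a] itself is nonzero. *)
have uK m (a : 'I_n) : (n - a <= m)%N -> (0 < a)%N -> u a ord_max = 0.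
  elim: m a => [|m ih] a; first by rewrite leqn0 subn_eq0 leqNgt ltn_ord.
  move=> am a0; have ka : (a.-1 < n)%N by rewrite (leq_trans _ (ltn_ord a)) // ltnS leq_pred.
  have := divK (Ordinal ka); rewrite (bigD1 a) //= big1 ?addr0 => [/eqP|a' a'a].
    rewrite mulf_eq0 => /orP[|/eqP //].
    rewrite -(rmorph0 (real_complex R)) (inj_eq (@complexI R)) -{1}(prednK a0).
    by rewrite (negbTE (dgstiff_succ_neq0 _ _)) // -ltnS prednK.
  have [lt|] := ltnP a a'.
    have a'm : (n - a' <= m)%N.
      by rewrite -ltnS; apply: leq_trans am; rewrite ltn_sub2l.
    by rewrite (ih a' a'm) ?mulr0 //; exact: leq_trans lt.
  rewrite leq_eqVlt => /orP[/eqP/val_inj e|lt]; first by rewrite e eqxx in a'a.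
  rewrite dgstiff_eq0 ?rmorph0 ?mul0r //=; first by rewrite -ltnS prednK.
  exact: n4 (Ordinal ka).
(* Only the constant x-mode survives, and its jump is t_x - 1 times its coefficient. *)
have /matrixP/(_ 0 ord_max) := ju; rewrite mxE [RHS]mxE (bigD1 ord0) //= big1 => [|a a0].
  rewrite addr0 !mxE /= !hornerC rmorph1 mulr1 => /eqP.
  by rewrite mulf_eq0 subr_eq0 (negbTE t1) => /eqP.
by rewrite (uK n) ?mulr0 ?leq_subr // lt0n.
Qed.

(** For 0 < h < pi / |k| the phase has modulus strictly between 0 and pi, so its sine is nonzero. *)
Lemma near_cexpi_neq1 (k : R) : k != 0 -> \forall h \near 0^'+, cexpi (k * h) != 1.
Proof.
move=> k0; have k1 : 0 < `|k| by rewrite normr_gt0.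
apply: filterS (near_right_lt (divr_gt0 (pi_gt0 R) k1)) => h /andP[h0 hpi].
apply/eqP => /(congr1 (@complex.Im R)) /= s0.
have : 0 < sin (`|k| * h).
  by apply: sin_gt0_pi; rewrite mulr_gt0 //= mulrC -ltr_pdivlMr.
case: (ger0P k) => _; first by rewrite s0 ltxx.
by rewrite mulNr sinN s0 oppr0 ltxx.
Qed.

End KernelTop.

Theorem mainTheorem5 (R : realType) (K : nat) (kx ky : R) :
  K \in [:: 1; 2; 3]%N ->
  kx * ky != 0 ->
  ~ exists proj : R -> 'cV[R[i]]_(ndof K) -> 'cV[R[i]]_(ndof K),
      selectively_optimal_projector
        (fun h => evolution K (Dx_upwind R) (Dy_upwind R) kx ky h h) proj /\
      (forall r : 'I_(ndof K),
         isO_right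
           (fun h => DOF K kx ky h h (Qhat kx ky) r 0
                     - proj h (DOF K kx ky h h (Qhat kx ky)) r 0)
           K.+1).
Proof.
move=> Kin; rewrite mulf_eq0 negb_or => /andP[kx0 ky0] [proj [[ker _] dofO]].
have K4 : (K < 4)%N by move: Kin; rewrite !inE => /or3P[] /eqP->.
have [m m0 hm] := DOF_lower K4 kx0 ky0.
have /eqO_exP [M M0 hM] := dofO (enum_rank (ord0, ord_max, ord0)).
(* Below this threshold m h^K <= M h^(K+1) fails, which gives the contradiction. *)
have e0 : 0 < m / M by rewrite divr_gt0.
near (0 : R)^'+ => h.
have /andP[h0 hlt] : 0 < h < m / M by near: h; exact: near_right_lt.
have t1 : cexpi (kx * h) != 1 by near: h; exact: near_cexpi_neq1.
have lo : m * h ^+ K <= Normc.normc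
  (DOF K kx ky h h (Qhat kx ky) (enum_rank (ord0, ord_max, ord0)) 0) by near: h.
(* The projection lies in the kernel, so the error in this entry is the whole degree of freedom. *)
have p0 := evolution_kernel_top K4 h0 t1 (ker h (DOF K kx ky h h (Qhat kx ky)) h0).
have : `|Normc.normc (DOF K kx ky h h (Qhat kx ky) (enum_rank (ord0, ord_max, ord0)) 0
    - proj h (DOF K kx ky h h (Qhat kx ky)) (enum_rank (ord0, ord_max, ord0)) 0)|
    <= M * `|h ^+ K.+1| by near: h.
rewrite p0 subr0 => /(le_trans (ler_norm _)) /(le_trans lo).
rewrite gtr0_norm ?exprn_gt0 // exprS mulrA ler_pM2r ?exprn_gt0 //.
by rewrite leNgt mulrC -ltr_pdivlMr // hlt.
Unshelve. all: by end_near. Qed.
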